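(* Let $\mathcal{P}$ be a symmetric chain order and let $n \geq 1$ be an integer. Then the quotient poset $\mathcal{P}^n/\mathbb{Z}_n$ is a symmetric chain order.
   Context: A finite poset $(\mathcal{P},<)$ is ranked if there is a function $\mathrm{rk}:\mathcal{P}\to\mathbb{Z}_{\geq 0}$ such that whenever $y$ covers $x$ (i.e. $x<y$ and no $z$ satisfies $x<z<y$) we have $\mathrm{rk}(y)=\mathrm{rk}(x)+1$. The rank of $\mathcal{P}$ is $\mathrm{rk}(\mathcal{P})=\max_{x}\mathrm{rk}(x)+\min_{x}\mathrm{rk}(x)$. A saturated chain $x_1\lessdot x_2\lessdot\dots\lessdot x_k$ (each element covered by the next) is rank-symmetric if $\mathrm{rk}(x_1)+\mathrm{rk}(x_k)=\mathrm{rk}(\mathcal{P})$. A symmetric chain order is a finite ranked poset which can be written as a disjoint union of saturated, rank-symmetric chains. The product $\mathcal{P}^n$ carries the componentwise order with rank equal to the sum of the ranks of the coordinates. The cyclic group $\mathbb{Z}_n$ acts on $\mathcal{P}^n$ by cyclically permuting the factors; $\mathcal{P}^n/\mathbb{Z}_n$ is the set of orbits, ordered by $[x]\leq[y]$ iff there exist $x'$ in the orbit of $x$ and $y'$ in the orbit of $y$ with $x'\leq y'$ in $\mathcal{P}^n$, and ranked by the rank of any representative. *)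

(* Defs.v *)
From HB Require Import structures.
From mathcomp Require Import all_boot all_order all_fingroup.

Set Implicit Arguments.
Unset Strict Implicit.
Unset Printing Implicit Defensive.

Import Order.Theory.
Import GroupScope.

Section SymmetricChainOrder.
Context {d : Order.disp_t} {T : finPOrderType d}.
Implicit Types (x y z : T) (rk : T -> nat) (A : {set T}) (C : {set {set T}}).

Definition covers x y : bool :=
  (x < y)%O && [forall z, ~~ ((x < z)%O && (z < y)%O)].

Definition rank_function rk : Prop :=
  forall x y, covers x y -> rk y = (rk x).+1.

Definition max_rank rk : nat := \max_x rk x.

(* [minn] has no neutral element on [nat]; starting the iteration at the
   maximum yields the minimum whenever [T] is inhabited. *)
Definition min_rank rk : nat := \big[minn/max_rank rk]_x rk x.

Definition poset_rank rk : nat := (max_rank rk + min_rank rk)%N.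

Definition symmetric_chain rk A : Prop :=
  exists x s, [/\ A =i x :: s, path covers x s
                & (rk x + rk (last x s))%N = poset_rank rk].

(* The rank function is an explicit argument because a disconnected poset has
   several of them. *)
Definition symmetric_chain_order rk : Prop :=
  rank_function rk /\
  exists C, partition C [set: T] /\ {in C, forall A, symmetric_chain rk A}.

End SymmetricChainOrder.

Section Necklace.
Context {d : Order.disp_t} (P : finPOrderType d) (n : nat).
Implicit Types (x y : n.-tupleprod P) (s : 'S_n).

Definition permute_coords x s : n.-tupleprod P := [tuple tnth x (s^-1 i) | i < n].

Lemma tnth_permute x s i : tnth (permute_coords x s) i = tnth x (s^-1 i).
Proof. by rewrite tnth_mktuple. Qed.

Fact permute_coords1 x : permute_coords x 1 = x.
Proof. by apply: eq_from_tnth => i; rewrite tnth_permute invg1 perm1. Qed.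

Fact permute_coordsM x s t :
  permute_coords x (s * t) = permute_coords (permute_coords x s) t.
Proof. by apply: eq_from_tnth => i; rewrite !tnth_permute invMg permM. Qed.

Definition coord_action := TotalAction permute_coords1 permute_coordsM.

(* [ordS] sends [i] to [i.+1 %% n]: this cycle generates a copy of Z/n in
   ['S_n]. *)
Definition cyclic_shifts : {group 'S_n} := <[perm (@ordS_inj n)]>%G.

Definition necklaces : {set {set n.-tupleprod P}} :=
  [set orbit coord_action cyclic_shifts x | x in [set: n.-tupleprod P]].

Record necklace : predArgType := Necklace {
  necklace_set : {set n.-tupleprod P};
  _ : necklace_set \in necklaces
}.

HB.instance Definition _ := [isSub for necklace_set].
HB.instance Definition _ := [Finite of necklace by <:].

Implicit Types (a b c : necklace).

Definition necklace_le a b : bool :=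
  [exists x in val a, exists y in val b, (x <= y)%O].

Lemma permute_le x y s :
  (x <= y)%O -> (permute_coords x s <= permute_coords y s)%O.
Proof.
rewrite !Order.TupleProdOrder.leEtprod => /forallP xy.
by apply/forallP => i; rewrite !tnth_permute.
Qed.

Lemma necklaceE a x : x \in val a -> val a = orbit coord_action cyclic_shifts x.
Proof.
by case: a => A /= /imsetP[y _ ->] /orbit_in_eqP-> //; apply/subsetP.
Qed.

Lemma necklaceJ a x s :
  x \in val a -> s \in cyclic_shifts -> permute_coords x s \in val a.
Proof. by move=> xa sG; rewrite (necklaceE xa); apply/orbitP; exists s. Qed.

Lemma necklace_neq0 a : exists x, x \in val a.
Proof. by case: a => A /= /imsetP[x _ ->]; exists x; apply: orbit_refl. Qed.

Lemma necklace_leP a b x :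
  x \in val a -> reflect (exists2 y, y \in val b & (x <= y)%O) (necklace_le a b).
Proof.
move=> xa; apply: (iffP exists_inP) => [[x' x'a /exists_inP[y yb x'y]]|].
  move: xa; rewrite (necklaceE x'a) => /orbitP[s sG <-].
  by exists (permute_coords y s); [apply: necklaceJ | apply: permute_le].
by case=> y yb xy; exists x => //; apply/exists_inP; exists y.
Qed.

Fact necklace_le_refl : reflexive necklace_le.
Proof.
by move=> a; have [x xa] := necklace_neq0 a; apply/(necklace_leP _ xa); exists x.
Qed.

Fact necklace_le_trans : transitive necklace_le.
Proof.
move=> b a c ab bc; have [x xa] := necklace_neq0 a.
have /(necklace_leP _ xa)[y yb xy] := ab.
have /(necklace_leP _ yb)[z zc yz] := bc.
by apply/(necklace_leP _ xa); exists z => //; apply: le_trans yz.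
Qed.

Lemma le_permute_eq x s : (x <= permute_coords x s)%O -> permute_coords x s = x.
Proof.
move=> xs; have up k : (x <= permute_coords x (s ^+ k))%O.
  elim: k => [|k IHk]; first by rewrite expg0 permute_coords1.
  by rewrite expgSr permute_coordsM (le_trans xs) ?permute_le.
apply: le_anti; rewrite xs andbT -[leRHS]permute_coords1 -(expg_order s).
by rewrite -(prednK (order_gt0 s)) expgSr permute_coordsM permute_le.
Qed.

Fact necklace_le_anti : antisymmetric necklace_le.
Proof.
move=> a b /andP[ab ba]; have [x xa] := necklace_neq0 a.
have /(necklace_leP _ xa)[y yb xy] := ab.
have /(necklace_leP _ yb)[z za yz] := ba.
have := za; rewrite (necklaceE xa) => /orbitP[s sG] /= xsz.
have xz : z = x by rewrite -xsz; apply: le_permute_eq; rewrite xsz (le_trans xy).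
have xyE : x = y by apply: le_anti; rewrite xy -[leRHS]xz.
by apply: val_inj; rewrite (necklaceE xa) (necklaceE yb) xyE.
Qed.

Fact necklace_display : Order.disp_t. Proof. exact: Order.Disp tt tt. Qed.

HB.instance Definition _ := Order.Le_isPOrder.Build necklace_display necklace
  necklace_le_refl necklace_le_anti necklace_le_trans.

Definition power_rank (rk : P -> nat) x : nat := \sum_(i < n) rk (tnth x i).

Definition necklace_rank (rk : P -> nat) a : nat :=
  power_rank rk (xchoose (necklace_neq0 a)).

Lemma power_rank_permute rk x s :
  power_rank rk (permute_coords x s) = power_rank rk x.
Proof.
rewrite /power_rank (reindex_inj (@perm_inj _ s)) /=.
by apply: eq_bigr => i _; rewrite tnth_permute permK.
Qed.

Lemma necklace_rankE rk a x : x \in val a -> necklace_rank rk a = power_rank rk x.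
Proof.
move=> xa; rewrite /necklace_rank.
have : xchoose (necklace_neq0 a) \in orbit coord_action cyclic_shifts x.
  by rewrite -(necklaceE xa); apply: xchooseP.
by case/orbitP => s _ <-; apply: power_rank_permute.
Qed.

End Necklace.

(* Main.v *)
(* Replace each letter of a word of P^n by its position c in a chain of length k
   of the decomposition, and read it as the bracket string ")" ^ (k - c) "(" ^ c.
   Writing the n strings on a circle and matching brackets cyclically, a word of
   low rank has only unmatched ")", and flipping all of them is a
   rotation-equivariant involution onto the words of complementary rank.

   A low word with at least two unmatched ")" moves up as follows: among the
   fully matched blocks between consecutive unmatched ")", take a heaviest one
   and match the two brackets around it, i.e. flip the ")" preceding it.  The new
   matched pair encloses strictly more than any other, so the previous word is
   recovered by undoing the unique heaviest pair: on orbits the move is injective,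
   whatever choice was made between blocks of equal weight, and no special
   treatment of words with rotational symmetry is needed.  Conjugated by the
   involution, the same move goes down from high words.  Symmetric chains are the
   orbits of the upward move below the middle, glued to their images above it. *)

Require Import Defs.
From mathcomp Require Import all_boot all_order all_fingroup all_algebra zify.

Set Implicit Arguments.
Unset Strict Implicit.
Unset Printing Implicit Defensive.

Import Order.Theory GRing.Theory Num.Theory.

(** * Covers and ranks in finite ranked posets *)

Section RankedPoset.
Context {d : Order.disp_t} {T : finPOrderType d}.
Implicit Types (x y z : T).
Local Open Scope order_scope.

Lemma covers_between x y : x < y -> exists2 z, covers x z & z <= y.
Proof.
have [m] := ubnP #|[set z | x < z < y]|; elim: m y => // m IHm y le_m xy.
have [/existsP[z /andP[xz zy]]|no_z] := boolP [exists z, (x < z) && (z < y)].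
  have [|z' xz' z'z] := IHm z _ xz; last by exists z' => //; apply: le_trans z'z (ltW zy).
  rewrite -ltnS; apply: leq_trans le_m; apply: proper_card; apply/properP; split.
    by apply/subsetP => w; rewrite !inE => /andP[-> /lt_trans->].
  by exists z; rewrite !inE ?xz ?zy // ltxx andbF.
by exists y => //; rewrite /covers xy -negb_exists.
Qed.

Variable rk : T -> nat.

Lemma max_rank_eq x : (forall y, rk y <= rk x)%N -> max_rank rk = rk x.
Proof.
move=> le_x; apply/eqP; rewrite eqn_leq leq_bigmax_cond // andbT.
by apply/bigmax_leqP => y _.
Qed.

Lemma min_rank_eq x : (forall y, rk x <= rk y)%N -> min_rank rk = rk x.
Proof.
move=> ge_x; apply/eqP; rewrite eqn_leq; apply/andP; split.
  by rewrite /min_rank -minEnat -leEnat bigmin_le_cond.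
rewrite /min_rank; elim/big_ind: _ => [|y z|y _] //.
  exact: leq_bigmax.
by move=> xy xz; rewrite leq_min xy.
Qed.

Hypothesis rk_covers : rank_function rk.

Lemma rank_lt x y : x < y -> (rk x < rk y)%N.
Proof.
have [m] := ubnP #|[set z | x < z]|; elim: m x => // m IHm x le_m xy.
have [z xz] := covers_between xy; rewrite le_eqVlt => /orP[/eqP<-|zy].
  by rewrite (rk_covers xz).
apply: leq_trans (IHm z _ zy); first by rewrite (rk_covers xz).
have lt_xz : x < z by case/andP: xz.
rewrite -ltnS; apply: leq_trans le_m; apply: proper_card; apply/properP; split.
  by apply/subsetP => w; rewrite !inE; apply: lt_trans.
by exists z; rewrite !inE ?ltxx.
Qed.

End RankedPoset.

(** * A criterion for symmetric chains: a rank-complementing involution and an injective upward move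
    below the middle *)

Section SymmetricChains.
Context {d : Order.disp_t} {T : finPOrderType d}.
Variables (rk : T -> nat) (dual up : T -> T).
Implicit Types (x y z : T).

Local Notation R := (poset_rank rk).
Local Notation low := (fun x => 2 * rk x <= R)%N.

Hypothesis rk_covers : rank_function rk.
Hypothesis rk_dual : forall x, (rk x + rk (dual x))%N = R.
Hypothesis dualK : involutive dual.
Hypothesis covers_up : forall x, (2 * rk x + 2 <= R)%N -> covers x (up x).
Hypothesis covers_dual_up :
  forall x, (2 * rk x + 2 <= R)%N -> covers (dual (up x)) (dual x).
Hypothesis up_inj : forall x y, (2 * rk x + 2 <= R)%N -> (2 * rk y + 2 <= R)%N ->
  up x = up y -> x = y.
Hypothesis covers_dual : forall x, (2 * rk x + 1)%N = R -> covers x (dual x).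
Hypothesis dual_mid : forall x, (2 * rk x)%N = R -> dual x = x.

Lemma rk_up x : (2 * rk x + 2 <= R)%N -> rk (up x) = (rk x).+1.
Proof. by move/covers_up/rk_covers. Qed.

Lemma rk_iter_up x i : (2 * (rk x + i) <= R)%N -> rk (iter i up x) = (rk x + i)%N.
Proof.
elim: i => [|i IHi] xi; first by rewrite addn0.
by rewrite /= rk_up IHi; lia.
Qed.

(* Meaningful for [x] of low rank only. *)
Definition chain_from x : {set T} :=
  [set y | [exists i : 'I_R.+1, (2 * (rk x + i) <= R)%N &&
     ((y == iter i up x) || (y == dual (iter i up x)))]].

Lemma chain_fromP x y : reflect
  (exists2 i, (2 * (rk x + i) <= R)%N & y = iter i up x \/ y = dual (iter i up x))
  (y \in chain_from x).
Proof.
rewrite inE; apply: (iffP existsP) => [[i /andP[xi /orP yi]]|[i xi yi]].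
  by exists i => //; case: yi => /eqP; [left|right].
have iR : (i < R.+1)%N by lia.
by exists (Ordinal iR); rewrite xi; apply/orP; case: yi => /eqP; [left|right].
Qed.

Lemma chain_from_up x y : (2 * rk x + 2 <= R)%N ->
  (y \in chain_from x) = [|| y == x, y == dual x | y \in chain_from (up x)].
Proof.
move=> xR; apply/chain_fromP/or3P => [[[|i] xi yi]|].
- by case: yi => ->; rewrite eqxx; [constructor 1|constructor 2].
- constructor 3; apply/chain_fromP; exists i; first by rewrite rk_up //; lia.
  by rewrite -iterSr.
case=> [/eqP->|/eqP->|/chain_fromP[i]].
- by exists 0%N => //; [lia|left].
- by exists 0%N => //; [lia|right].
by rewrite rk_up // => xi yi; exists i.+1; [lia|rewrite iterSr].
Qed.

(** Induction on the distance to the middle: the chain of [x] is that of [up x] with [x] put in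
    front and [dual x] behind. The base cases are one element in the middle rank and a pair [x],
    [dual x] around it. *)
Lemma chain_from_path x : low x ->
  exists s, [/\ chain_from x =i x :: s, path covers x s & last x s = dual x].
Proof.
have [m] := ubnP (R - 2 * rk x)%N; elim: m x => // m IHm x xm xR.
have [x_mid|x_lt] := ltnP (R - 2 * rk x) 2; last first.
  have [||s [sE s_path s_last]] := IHm (up x); rewrite ?rk_up; [lia..|].
  exists (rcons (up x :: s) (dual x)); split=> [y||]; last by rewrite last_rcons.
    rewrite chain_from_up; last lia.
    rewrite sE !in_cons mem_rcons !in_cons; congr orb.
    exact: orbCA.
  rewrite rcons_path /= s_path s_last covers_up ?covers_dual_up //; lia.
have iE i : (2 * (rk x + i) <= R)%N -> i = 0%N by lia.
have E y : (y \in chain_from x) = (y == x) || (y == dual x).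
  apply/chain_fromP/orP => [[i /iE->//= [->|->]]|]; rewrite ?eqxx; auto.
  by case=> /eqP->; exists 0%N; rewrite ?addn0 //; [left|right].
have [mid|odd] := eqVneq (2 * rk x)%N R.
  by exists [::]; split=> // [y|]; rewrite /= ?E ?inE dual_mid ?orbb.
exists [:: dual x]; split=> //= [y|]; first by rewrite E !inE.
by rewrite covers_dual //; lia.
Qed.

Definition chain_bottom x : bool :=
  low x && [forall w, (2 * rk w + 2 <= R)%N ==> (up w != x)].

(** Chains are stable under [dual], so a low [y] suffices; a low element that is no bottom is [up w]
    for some [w] of smaller rank. *)
Lemma chain_bottom_exists y : exists2 x, chain_bottom x & y \in chain_from x.
Proof.
wlog: y / low y => [low_case|].
  have [/low_case//|yR] := leqP (2 * rk y) R.
  have [|x xb /chain_fromP[i xi yi]] := low_case (dual y).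
    by have := rk_dual y; lia.
  exists x => //; apply/chain_fromP; exists i => //.
  by case: yi => [<-|/(can_inj dualK)]; [right; rewrite dualK|left].
have [m] := ubnP (rk y); elim: m y => // m IHm y ym yR.
have [yb|] := boolP (chain_bottom y).
  by exists y => //; apply/chain_fromP; exists 0%N; [rewrite addn0|left].
rewrite /chain_bottom yR /= negb_forall => /existsP[w].
rewrite negb_imply negbK => /andP[wR /eqP wy].
have [||x xb /chain_fromP[i xi wi]] := IHm w; [by rewrite -wy rk_up // in ym|lia|].
exists x => //; apply/chain_fromP.
have wE : w = iter i up x.
  case: wi => // wi; have := rk_dual (iter i up x).
  by rewrite -wi rk_iter_up //; lia.
exists i.+1; last by left; rewrite iterS -wE.
have := rk_iter_up xi; rewrite -wE; lia.
Qed.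

(** Injectivity of [up] cancels common steps until the shorter iterate is a bottom, which is not
    [up] of any element low enough. *)
Lemma chain_bottom_unique x x' y : chain_bottom x -> chain_bottom x' ->
  y \in chain_from x -> y \in chain_from x' -> x = x'.
Proof.
move=> xb xb' /chain_fromP[i xi yi] /chain_fromP[i' xi' yi'].
have E : iter i up x = iter i' up x'.
  (* The ranks of [a] and [b] add up to [R] and neither exceeds half of it, so both lie in the
     middle rank, where [dual] is the identity. *)
  have low_dual a b : low a -> low b -> a = dual b -> a = b.
    by move=> aR bR E; rewrite E dual_mid // -?E; have := rk_dual b; rewrite -E; lia.
  have lowi : low (iter i up x) by rewrite rk_iter_up.
  have lowi' : low (iter i' up x') by rewrite rk_iter_up.
  case: yi yi' => -> [E|E]; [exact: E|exact: low_dual|symmetry; exact: low_dual|].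
  exact: (can_inj dualK).
wlog ii' : x x' i i' xb xb' xi xi' E {yi yi'} / (i <= i')%N => [wlog_le|].
  by have [le|/ltnW le] := leqP i i'; [|symmetry]; apply: wlog_le le.
elim: i i' xi xi' E ii' => [|i IHi] [|i'] // xi xi' /= E ii'.
  have /andP[_ /forallP/(_ (iter i' up x'))] := xb.
  by rewrite -E eqxx implybF rk_iter_up; lia.
by apply: (IHi i') => //; [lia|lia|apply: up_inj => //; rewrite rk_iter_up; lia].
Qed.

Lemma symmetric_chain_order_up : symmetric_chain_order rk.
Proof.
split=> //.
exists [set chain_from x | x in chain_bottom]; split; last first.
  move=> _ /imsetP[x /andP[xR _] ->]; have [s [sE s_path s_last]] := chain_from_path xR.
  by exists x, s; split; rewrite ?s_last.
apply/and3P; split.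
- apply/eqP/setP => y; rewrite inE; have [x xb yx] := chain_bottom_exists y.
  by apply/bigcupP; exists (chain_from x) => //; apply: imset_f.
- apply/trivIsetP => _ _ /imsetP[x xb ->] /imsetP[x' xb' ->].
  apply: contraNT => /pred0Pn[y /andP[yx yx']].
  by rewrite (chain_bottom_unique xb xb' yx yx').
apply/imsetP => -[x /andP[xR _] x0].
have : x \in chain_from x by apply/chain_fromP; exists 0%N; [rewrite addn0|left].
by rewrite -x0 inE.
Qed.

End SymmetricChains.

(** * Circular bracket words *)

Definition prefix_sum (f : nat -> nat) t : nat := \sum_(q < t) f q.

Lemma prefix_sumS f t : prefix_sum f t.+1 = (prefix_sum f t + f t)%N.
Proof. by rewrite /prefix_sum big_ord_recr. Qed.

Lemma periodic_mod (T : Type) n (f : nat -> T) t :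
  (forall q, f (q + n) = f q) -> f (t %% n) = f t.
Proof.
move=> fn; rewrite [in RHS](divn_eq t n) addnC.
by elim: (t %/ n) => [|q IHq]; rewrite ?addn0 // mulSnr addnA fn.
Qed.

Lemma prefix_sum_mono f s t : (s <= t)%N -> (prefix_sum f s <= prefix_sum f t)%N.
Proof.
move=> /subnK <-; elim: (t - s)%N => // e IHe; rewrite addSn prefix_sumS; lia.
Qed.

Lemma prefix_sum_shift f e t :
  (prefix_sum (fun q => f (q + e)%N) t + prefix_sum f e = prefix_sum f (t + e))%N.
Proof.
elim: t => [|t IHt]; first by rewrite /prefix_sum big_ord0 add0n.
rewrite addSn !prefix_sumS; lia.
Qed.

Lemma prefix_sum_periodic n f t : (forall q, f (q + n)%N = f q) ->
  prefix_sum f (t + n) = (prefix_sum f t + prefix_sum f n)%N.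
Proof.
by move=> fn; rewrite -prefix_sum_shift; congr addn; apply: eq_bigr.
Qed.

Local Open Scope ring_scope.

(** The seed [f t] reappears as the term [l = 0], so it does not affect the minimum when [n] is
    positive. *)
Definition window_min n (f : nat -> int) t : int :=
  \big[Order.min/f t]_(l < n) f (t + l)%N.

Section WindowMin.
Variables (n : nat) (f : nat -> int).
Implicit Types (t q : nat).

Lemma window_min_le t q : (t <= q < t + n)%N -> window_min n f t <= f q.
Proof.
move=> tq; have qt : (q - t < n)%N by lia.
have -> : q = (t + Ordinal qt)%N by rewrite /=; lia.
exact: (bigmin_le_cond (f t) (fun l : 'I_n => f (t + l)%N)).
Qed.

Hypothesis n_gt0 : (0 < n)%N.

Lemma window_min_attained t :
  exists2 q, (t <= q < t + n)%N & window_min n f t = f q.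
Proof.
pose F (l : 'I_n) := f (t + l)%N.
have ft : f t = F (Ordinal n_gt0) by rewrite /F /= addn0.
rewrite /window_min ft.
have [i Fi] : exists i, \big[Order.min/F (Ordinal n_gt0)]_(l < n) F l = F i; last first.
  by exists (t + i)%N => //; have := ltn_ord i; lia.
elim/big_ind: _ => [|a b [i ->] [j ->]|i _]; [by eexists| |by exists i].
by rewrite /Order.min; case: ifP => _; [exists i|exists j].
Qed.

Lemma window_min_eq t w : (forall q, (t <= q < t + n)%N -> w <= f q) ->
  (exists2 q, (t <= q < t + n)%N & w = f q) -> window_min n f t = w.
Proof.
move=> lew [q tq wq]; have := window_min_le tq.
have [r /lew] := window_min_attained t; lia.
Qed.

Lemma window_first_min t : exists r, [/\ (t <= r < t + n)%N,
  forall q, (t <= q < t + n)%N -> f r <= f q &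
  forall q, (t <= q < r)%N -> f r < f q].
Proof.
pose P r := (t <= r)%N && (f r <= window_min n f t).
have [q0 tq0 wq0] := window_min_attained t.
have : exists r, P r by exists q0; rewrite /P wq0; lia.
case/ex_minnP => r /andP[tr rw] min_r.
have rq0 : (r <= q0)%N by apply: min_r; rewrite /P wq0; lia.
exists r; split=> [|q tq|q tq]; [lia|exact: le_trans (window_min_le tq)|].
apply: le_lt_trans rw _; rewrite ltNge; apply/negP => qw.
have := min_r q; rewrite /P qw; lia.
Qed.
End WindowMin.

Section Brackets.
Variables (n : nat) (k c : nat -> nat).

(* Letter [t] is the bracket string ")" ^ (k t - c t) "(" ^ (c t), in the periodic
   extension to [nat] of a circular word; [valley t] is the height reached after
   its closing brackets. *)
Definition valley t : int := (2 * prefix_sum c t + c t)%:Z - (prefix_sum k t.+1)%:Z.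

Definition deficit : int := (prefix_sum k n)%:Z - (2 * prefix_sum c n)%:Z.

(* By periodicity, this is the minimum of all valleys before letter [t + n] when
   [deficit] is nonnegative. *)
Definition running_min : nat -> int := window_min n valley.

(* For a nonnegative [deficit], [running_min t - running_min t.+1] counts the
   unmatched closing brackets of letter [t]; for a negative one it is minus the
   number of unmatched opening brackets. *)
Definition flip t : nat := `|((c t)%:Z + running_min t - running_min t.+1)%R|%N.

Local Notation m := valley.
Local Notation u := deficit.
Local Notation W := running_min.

Lemma valleyS t : m t.+1 = m t + (c t)%:Z + (c t.+1)%:Z - (k t.+1)%:Z.
Proof. rewrite /valley !prefix_sumS; lia. Qed.

Lemma running_min_le t q : (t <= q < t + n)%N -> W t <= m q.
Proof. exact: window_min_le. Qed.

Hypotheses (n_gt0 : (0 < n)%N) (kn : forall t, k (t + n)%N = k t).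
Hypotheses (cn : forall t, c (t + n)%N = c t) (ck : forall t, (c t <= k t)%N).

Lemma valleyDn t : m (t + n)%N = m t - u.
Proof.
rewrite /valley /deficit -addSn (prefix_sum_periodic _ kn) (prefix_sum_periodic _ cn) cn.
lia.
Qed.

Lemma running_min_attained t : exists2 q, (t <= q < t + n)%N & W t = m q.
Proof. exact: window_min_attained. Qed.

Lemma running_minDn t : W (t + n)%N = W t - u.
Proof.
apply: window_min_eq => // [q tq|].
  have := @running_min_le t (q - n)%N; have := valleyDn (q - n)%N.
  rewrite subnK; last lia.
  lia.
have [q tq ->] := running_min_attained t; exists (q + n)%N; first lia.
by rewrite valleyDn.
Qed.

(** Moving the window by one letter trades the valley [m t] for [m (t + n) = m t - u], which is no
    higher: the minimum can only fall, and then to the new valley. *)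
Lemma running_minS_le t : 0 <= u ->
  W t.+1 <= W t /\ (W t.+1 < W t -> W t.+1 = m (t + n)%N).
Proof.
move=> u0; have [q tq Wt] := running_min_attained t.
have [r tr WSt] := running_min_attained t.+1.
have := @running_min_le t.+1 q; have := @running_min_le t r.
have := @running_min_le t.+1 (t + n)%N; have := valleyDn t.
have [<-|] := eqVneq r (t + n)%N; have [qt|] := eqVneq q t; move: Wt; rewrite ?qt; lia.
Qed.

(** Here the entering valley is no lower than the departing [m t], so the minimum rises only if
    [m t] attained it. *)
Lemma running_minS_ge t : u <= 0 ->
  W t <= W t.+1 /\ (W t < W t.+1 -> W t = m t).
Proof.
move=> u0; have [q tq Wt] := running_min_attained t.
have [r tr WSt] := running_min_attained t.+1.
have := @running_min_le t.+1 q; have := @running_min_le t r.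
have := @running_min_le t t; have := valleyDn t.
have [rt|] := eqVneq r (t + n)%N; have [qt|] := eqVneq q t; move: Wt WSt; rewrite ?qt ?rt; lia.
Qed.

Lemma running_min_down s t : 0 <= u -> (s <= t)%N -> W t <= W s.
Proof.
move=> u0 /subnK <-; elim: (t - s)%N => // e IHe; rewrite addSn.
have [] := running_minS_le (e + s)%N u0; lia.
Qed.

Lemma running_min_up s t : u <= 0 -> (s <= t)%N -> W s <= W t.
Proof.
move=> u0 /subnK <-; elim: (t - s)%N => // e IHe; rewrite addSn.
have [] := running_minS_ge (e + s)%N u0; lia.
Qed.

(** For [0 <= u], when the minimum falls, [W t] is at most the valley before the new minimum, and
    the drop from there is at most the [k t - c t] closing brackets of letter [t]. For [u < 0], a
    rise starts from [m t], and the next valley is at most [c t] higher. *)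
Lemma flip_bounds t :
  0 <= (c t)%:Z + W t - W t.+1 <= (k t)%:Z.
Proof.
have ckt := ck t; have [u0|u0] := leP 0 u.
  have [] := running_minS_le t u0; have := @running_min_le t (t + n.-1)%N.
  have := valleyS (t + n.-1)%N; rewrite -addnS prednK // kn cn; lia.
have [|] := @running_minS_ge t; first lia.
have := @running_min_le t.+1 t.+1; have := valleyS t; have := ck t.+1; lia.
Qed.

Lemma flipE t : (flip t)%:Z = (c t)%:Z + W t - W t.+1.
Proof. rewrite /flip; have := flip_bounds t; lia. Qed.

Lemma flip_le t : (flip t <= k t)%N.
Proof. have := flip_bounds t; rewrite -flipE; lia. Qed.

Lemma flip_periodic t : flip (t + n) = flip t.
Proof.
have := flipE (t + n)%N; rewrite cn -addSn !running_minDn; have := flipE t; lia.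
Qed.

Lemma prefix_sum_flip t : (prefix_sum flip t)%:Z = (prefix_sum c t)%:Z + W 0%N - W t.
Proof.
elim: t => [|t IHt]; first by rewrite /prefix_sum !big_ord0; lia.
rewrite !prefix_sumS; have := flipE t; lia.
Qed.

Lemma sum_flip : (prefix_sum flip n + prefix_sum c n = prefix_sum k n)%N.
Proof.
have := prefix_sum_flip n; have := running_minDn 0; rewrite add0n /deficit; lia.
Qed.
End Brackets.

(** * The flip is an involution *)

Section FlipInvolution.
Variables (n : nat) (k c : nat -> nat).
Hypotheses (n_gt0 : (0 < n)%N) (kn : forall t, k (t + n)%N = k t).
Hypotheses (cn : forall t, c (t + n)%N = c t) (ck : forall t, (c t <= k t)%N).
Local Notation m := (valley k c).
Local Notation u := (deficit n k c).
Local Notation W := (running_min n k c).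
Local Notation z := (flip n k c).

Lemma valley_flip t : valley k z t = m t + 2 * W 0%N - W t - W t.+1.
Proof.
have := prefix_sum_flip n_gt0 kn cn ck t; have := flipE n_gt0 kn cn ck t.
rewrite /valley; lia.
Qed.

(** [flip] subtracts the increments of [W]; as the running minimum gets reflected, a second flip
    adds them back, whence [flipK]. *)
Lemma running_min_flip t : running_min n k z t = 2 * W 0%N + u - W t.
Proof.
have Wn := running_minDn n_gt0 kn cn t.
apply: window_min_eq => // [q tq|].
  rewrite valley_flip; have [u0|u0] := leP 0 u.
    have := running_min_down n_gt0 kn cn u0 (proj1 (andP tq)).
    have := @running_min_le n k c q.+1 (q + n)%N; have := valleyDn n_gt0 kn cn q; lia.
  have := @running_min_up n k c n_gt0 kn cn q.+1 (t + n)%N.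
  have := @running_min_le n k c q q; lia.
(* The bound is attained at the last rise of [W] in the window if [u < 0], at its first fall if
   [0 < u], and at any minimal valley if [u = 0], where [W] is constant. *)
have [u0|u0|u0] := ltgtP u 0.
- pose P e := (e < n)%N && (W (t + n - e.+1)%N < W (t + n)%N).
  have : exists e, P e by exists n.-1; rewrite /P prednK // addnK; lia.
  case/ex_minnP => e /andP[en We] min_e.
  exists (t + n - e.+1)%N; first lia.
  have eS : ((t + n - e.+1).+1 = t + n - e)%N by lia.
  rewrite valley_flip eS.
  have [|_] := @running_minS_ge n k c n_gt0 kn cn (t + n - e.+1)%N; first lia.
  have W_e : W (t + n - e)%N = W (t + n)%N.
    have := @running_min_up n k c n_gt0 kn cn (t + n - e)%N (t + n)%N.
    case: (e) en We min_e {eS} => [|e'] en We min_e; first by rewrite subn0.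
    have := min_e e'; rewrite /P; lia.
  rewrite eS; lia.
- pose P e := (W (t + e.+1)%N < W t).
  have : exists e, P e by exists n.-1; rewrite /P prednK //; lia.
  case/ex_minnP => e Pe min_e.
  have en : (e < n)%N by have := min_e n.-1; rewrite /P prednK //; lia.
  exists (t + e)%N; first lia.
  rewrite valley_flip.
  have [|_] := @running_minS_le n k c n_gt0 kn cn (t + e)%N; first lia.
  have := valleyDn n_gt0 kn cn (t + e)%N.
  have W_e : W (t + e)%N = W t.
    have := @running_min_down n k c n_gt0 kn cn t (t + e)%N.
    case: (e) en Pe min_e => [|e'] en Pe min_e; first by rewrite addn0.
    have := min_e e'; rewrite /P; lia.
  move: Pe; rewrite /P -addnS; lia.
- have [q tq Wq] := running_min_attained k c n_gt0 t.
  exists q => //; rewrite valley_flip.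
  have Wconst s : W s = W 0%N.
    have := @running_min_up n k c n_gt0 kn cn 0 s.
    have := @running_min_down n k c n_gt0 kn cn 0 s; lia.
  move: (Wconst q) (Wconst q.+1) (Wconst t); lia.
Qed.

Lemma flipK t : flip n k z t = c t.
Proof.
have zn := flip_periodic n_gt0 kn cn ck; have zk := flip_le n_gt0 kn cn ck.
have := flipE n_gt0 kn zn zk t; rewrite !running_min_flip.
have := flipE n_gt0 kn cn ck t; lia.
Qed.
End FlipInvolution.

Lemma eq_prefix_sum f g t : f =1 g -> prefix_sum f t = prefix_sum g t.
Proof. by move=> fg; apply: eq_bigr. Qed.

(** If none of the next [n] indices qualifies, [find] returns [n] and the value is [t + n + 1]. *)
Definition first_after n (r : rel int) (f : nat -> int) t : nat :=
  (t.+1 + find (fun l => r (f (t.+1 + l)%N) (f t)) (iota 0 n))%N.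

(* Number of opening brackets from letter [t] to the next letter with a lower
   ([r] is [<]) or no higher ([r] is [<=]) valley.  For [<=] this is the number of
   pairs enclosed by the first opening bracket of letter [t], itself included; for
   [<] and a [record] [t], it is the weight of the block after the last unmatched
   closing bracket of letter [t]. *)
Definition arc_weight n r k c t : nat :=
  (prefix_sum c (first_after n r (valley k c) t) - prefix_sum c t)%N.

Lemma first_after_le n (r : rel int) f t j :
  (t < j <= t + n)%N -> r (f j) (f t) -> (first_after n r f t <= j)%N.
Proof.
move=> tj rj; rewrite /first_after; set a := (X in find X _).
rewrite leqNgt; apply/negP => ltj.
have fj : (j - t.+1 < find a (iota 0 n))%N by lia.
have := before_find 0%N fj; rewrite nth_iota; last lia.
by rewrite /a add0n subnKC ?rj //; lia.
Qed.

Lemma first_after_eq n (r : rel int) f t j : (t < j <= t + n)%N -> r (f j) (f t) ->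
  (forall l, (t < l < j)%N -> ~~ r (f l) (f t)) -> first_after n r f t = j.
Proof.
move=> tj rj nr; have fj : (first_after n r f t <= j)%N by exact: first_after_le.
apply/eqP; rewrite eqn_leq fj /=; rewrite /first_after in fj *.
set a := (X in find X _) in fj *.
have fn : (find a (iota 0 n) < size (iota 0 n))%N by rewrite size_iota; lia.
have := nth_find 0%N (etrans (has_find a (iota 0 n)) fn).
rewrite nth_iota; last by rewrite size_iota in fn.
rewrite add0n => ra; rewrite leqNgt; apply/negP => lj.
by have /negP[] := nr (t.+1 + find a (iota 0 n))%N ltac:(lia).
Qed.

(* Letter [t] contains an unmatched closing bracket. *)
Definition record n k c t : Prop :=
  forall l, (t <= l < t + n)%N -> valley k c (t + n)%N < valley k c l.

Definition heaviest n k c t : Prop :=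
  record n k c t /\
  forall r, record n k c r -> (arc_weight n <%R k c r <= arc_weight n <%R k c t)%N.

(** * Equivariance under rotation of the circular word *)

Section Shift.
Variables (n e : nat) (k c k' c' : nat -> nat).
Hypotheses (n_gt0 : (0 < n)%N).
Hypotheses (k'E : forall t, k' t = k (t + e)%N) (c'E : forall t, c' t = c (t + e)%N).

Let delta := (prefix_sum k e)%:Z - (2 * prefix_sum c e)%:Z.

Lemma valley_shift t : valley k' c' t = valley k c (t + e)%N + delta.
Proof.
rewrite /valley (eq_prefix_sum _ c'E) (eq_prefix_sum _ k'E) c'E -addSn /delta.
have := prefix_sum_shift c e t; have := prefix_sum_shift k e t.+1; lia.
Qed.

Lemma running_min_shift t : running_min n k' c' t = running_min n k c (t + e)%N + delta.
Proof.
apply: window_min_eq => // [q tq|].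
  by rewrite valley_shift lerD2r; apply: running_min_le => //; lia.
have [q tq ->] := running_min_attained k c n_gt0 (t + e)%N.
exists (q - e)%N; first lia.
by rewrite valley_shift subnK //; lia.
Qed.

Lemma flip_shift t : flip n k' c' t = flip n k c (t + e)%N.
Proof. rewrite /flip !running_min_shift c'E -addSn; congr absz; lia. Qed.

Lemma arc_weight_shift (r : rel int) t : (forall x y z, r (x + z) (y + z) = r x y) ->
  arc_weight n r k' c' t = arc_weight n r k c (t + e)%N.
Proof.
move=> rD; rewrite /arc_weight.
have -> : first_after n r (valley k c) (t + e)
        = (first_after n r (valley k' c') t + e)%N.
  rewrite /first_after -addSn addnAC; congr (_ + _ + _)%N; apply: eq_find => l.
  by rewrite !valley_shift rD addnAC.
rewrite !(eq_prefix_sum _ c'E).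
have := prefix_sum_shift c e t.
have := prefix_sum_shift c e (first_after n r (valley k' c') t); lia.
Qed.

Lemma record_shift t : record n k' c' t <-> record n k c (t + e)%N.
Proof.
split=> rec l tl.
  have := rec (l - e)%N; rewrite !valley_shift subnK; last lia.
  rewrite addnAC ltrD2r; apply; lia.
by rewrite !valley_shift ltrD2r addnAC; apply: rec; lia.
Qed.
End Shift.

Lemma heaviest_exists n k c : (0 < n)%N ->
  (forall t, k (t + n)%N = k t) -> (forall t, c (t + n)%N = c t) ->
  0 < deficit n k c -> exists t, heaviest n k c t.
Proof.
move=> n_gt0 kn cn u_gt0.
have recn r : record n k c (r + n) <-> record n k c r.
  by apply: iff_sym; apply: record_shift => // t; rewrite ?kn ?cn.
have weightn r : arc_weight n <%R k c (r + n) = arc_weight n <%R k c r.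
  by rewrite -(@arc_weight_shift n n k c k c) // => x y z; rewrite ltrD2r.
pose rec t := [forall l : 'I_n, valley k c (t + n)%N < valley k c (t + l)%N].
have recP t : reflect (record n k c t) (rec t).
  apply: (iffP forallP) => [H l tl|H l]; last by apply: H; have := ltn_ord l; lia.
  have ln : (l - t < n)%N by lia.
  by have := H (Ordinal ln); rewrite /= subnKC //; lia.
(* The first lowest valley is a record: earlier ones are strictly higher, and every valley drops by
   [u > 0] after one turn. *)
have [i rec_i] : exists i : 'I_n, rec i.
  have [i [i_lt min_i first_i]] := window_first_min (valley k c) n_gt0 0.
  exists (Ordinal i_lt); apply/recP => l /= il.
  have := valleyDn n_gt0 kn cn i; have [ln|nl] := ltnP l n.
    have := min_i l; lia.
  have := first_i (l - n)%N; have := valleyDn n_gt0 kn cn (l - n)%N.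
  rewrite subnK //; lia.
have [j rec_j max_j] := @arg_maxnP _ i (fun i : 'I_n => rec i)
  (fun i : 'I_n => arc_weight n <%R k c i) rec_i.
exists j; split=> [|r]; first exact/recP.
suff : record n k c (r %% n) -> (arc_weight n <%R k c (r %% n) <= arc_weight n <%R k c j)%N.
  rewrite {3 4}(divn_eq r n) addnC.
  elim: (r %/ n)%N => [|q IHq]; first by rewrite mul0n addn0.
  by rewrite mulSnr addnA recn weightn.
by move/recP => rec_r; apply: (max_j (Ordinal (ltn_pmod r n_gt0))).
Qed.

(** * The upward move on a word whose heaviest block follows letter 0 *)

Section Raise.
Variables (n : nat) (k c : nat -> nat).
Hypotheses (n_gt0 : (0 < n)%N) (kn : forall t, k (t + n)%N = k t).
Hypotheses (cn : forall t, c (t + n)%N = c t).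

(** The last closing bracket of letter 0, unmatched when 0 is a record, becomes an opening one. *)
Definition raise t : nat := (c t + (t %% n == 0))%N.

Hypotheses (u_ge2 : 2 <= deficit n k c) (heavy : heaviest n k c 0).

Local Notation m := (valley k c).
Local Notation u := (deficit n k c).
Local Notation W := (running_min n k c).

Lemma raise_periodic t : raise (t + n) = raise t.
Proof. by rewrite /raise cn modnDr. Qed.

Lemma prefix_sum_raise t : (t <= n)%N -> prefix_sum raise t = (prefix_sum c t + (0 < t))%N.
Proof.
elim: t => [|t IHt] tn; first by rewrite /prefix_sum !big_ord0.
rewrite !prefix_sumS (IHt (ltnW tn)) /raise modn_small //; case: t {IHt tn} => *; lia.
Qed.

Lemma deficit_raise : deficit n k raise = u - 2.
Proof. rewrite /deficit prefix_sum_raise //; lia. Qed.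

Lemma valley_raise t : (t < n)%N -> valley k raise t = m t + 1 + (0 < t)%:Z.
Proof.
move=> tn; rewrite /valley (prefix_sum_raise (ltnW tn)) /raise modn_small //.
by case: t tn => /= *; lia.
Qed.

Lemma valley_raiseDn t : valley k raise (t + n)%N = valley k raise t - u + 2.
Proof. rewrite (valleyDn n_gt0 kn raise_periodic) deficit_raise; lia. Qed.

Lemma record_lt_cap : (c 0 < k 0)%N.
Proof.
have [/(_ n.-1)+ _] := heavy; have := valleyS k c n.-1.
have := kn 0; have := cn 0; rewrite prednK // !add0n; lia.
Qed.


Lemma valley_raise2 t : (n <= t < n + n)%N ->
  valley k raise t = m t + 3 + (n < t)%:Z.
Proof.
move=> tn; have := valley_raiseDn (t - n)%N; have := @valley_raise (t - n)%N.
have := valleyDn n_gt0 kn cn (t - n)%N; rewrite subnK; lia.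
Qed.

Lemma first_drop t j0 : (t < j0 <= t + n)%N -> m j0 < m t ->
  exists j, [/\ (t < j <= j0)%N, m j < m t,
    forall l, (t <= l < j)%N -> m t <= m l &
    arc_weight n <%R k c t = (prefix_sum c j - prefix_sum c t)%N].
Proof.
move=> tj0 mj0; pose P j := (t < j)%N && (m j < m t).
have : exists j, P j by exists j0; rewrite /P mj0; lia.
case/ex_minnP => j /andP[tj mj] min_j.
have ml l : (t < l < j)%N -> m t <= m l.
  by move=> lj; rewrite leNgt; apply/negP => ml; have := min_j l; rewrite /P ml; lia.
have jj0 : (j <= j0)%N by apply: min_j; rewrite /P mj0; lia.
exists j; split=> // [|l lj|]; first lia.
  by have [->//|lt] := eqVneq l t; apply: ml; lia.
by rewrite /arc_weight (@first_after_eq _ _ _ _ j) //; [lia|move=> l /ml; rewrite -leNgt].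
Qed.

Lemma record0_lt t : (t < n)%N -> m 0 - u < m t.
Proof.
case: heavy => rec _ tn; have := rec t; rewrite (valleyDn n_gt0 kn cn); lia.
Qed.

Lemma first_gap : exists j, [/\ (0 < j <= n)%N, m j < m 0,
  forall l, (l < j)%N -> m 0 <= m l & arc_weight n <%R k c 0 = prefix_sum c j].
Proof.
have := valleyDn n_gt0 kn cn 0; rewrite add0n => mn.
have [||j [jn mj ml ->]] := @first_drop 0 n; [lia|lia|exists j; split=> //].
by rewrite /prefix_sum big_ord0 subn0.
Qed.

Lemma raise_le t : (forall q, (c q <= k q)%N) -> (raise t <= k t)%N.
Proof.
move=> ck.
rewrite /raise -(periodic_mod t kn) -(periodic_mod t cn).
have := record_lt_cap; have := ck (t %% n)%N.
by case: eqP => [->|]; lia.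
Qed.

Variable j : nat.
Hypotheses (jn : (0 < j <= n)%N) (mj : m j < m 0).
Hypotheses (ml : forall l, (l < j)%N -> m 0 <= m l).

(** The valley of letter 0 rises by 1 and the following ones by 2, so the first strict drop, at [j],
    becomes the first weak one; the case [j = n] uses [2 <= u]. The successor counts the new pair
    itself. *)
Lemma arc_weight_raise0 : arc_weight n <=%R k raise 0 = (prefix_sum c j).+1.
Proof.
rewrite /arc_weight (@first_after_eq _ _ _ _ j) //.
- rewrite !prefix_sum_raise; [|lia|lia].
  rewrite {2}/prefix_sum big_ord0; lia.
- have := @valley_raise 0; have := @valley_raise j.
  have := valley_raiseDn 0; rewrite add0n; have [->|] := eqVneq j n; lia.
move=> l lj; rewrite -ltNge !valley_raise; [|lia|lia].
have := ml (proj2 (andP lj)); lia.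
Qed.

(** Valleys rise by 1 at letter 0, by 2 at letters 1 to [n - 1], by 3 at letter [n] and by 4 at the
    next ones. The minimum sits at letter [n] for [0 < t <= j] and past it for [j < t]; for [t = 0]
    it sits at a positive letter, or at 0 when [j = n]. *)
Lemma running_min_raise t : (t <= n)%N ->
  running_min n k raise t =
    W t + 3 + (j < t)%:Z - (t == 0%N)%:Z - ((t == 0%N) && (n <= j)%N)%:Z.
Proof.
move=> tn; have mn := valleyDn n_gt0 kn cn 0; rewrite add0n in mn.
have [q0 tq0 Wq0] := running_min_attained k c n_gt0 t.
have le_q0 q : (t <= q < t + n)%N -> m q0 <= m q.
  by rewrite -Wq0; apply: running_min_le.
rewrite Wq0; have lt_n q : (q < n)%N -> m n < m q.
  by move=> qn; have := record0_lt qn; lia.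
have ge_n q : (n <= q < n + j)%N -> m n <= m q.
  move=> nq; have := ml (_ : q - n < j)%N; have := valleyDn n_gt0 kn cn (q - n)%N.
  by rewrite subnK; lia.
have mnj := valleyDn n_gt0 kn cn j.
have v1 := valley_raise; have v2 := valley_raise2.
apply: window_min_eq => // [q tq|].
  have [t0|t_gt0] := posnP t.
    have := v1 q; have := le_q0 j; have := le_q0 q.
    by have [->|] := eqVneq q 0%N; lia.
  have [tj|jt] := leqP t j.
    have := le_q0 n; have := le_q0 q; have := lt_n q; have := v1 q; have := v2 q.
    by have [->|] := eqVneq q n; lia.
  have := le_q0 (j + n)%N; have := le_q0 q; have := lt_n q; have := v1 q.
  have := lt_n j; have := v2 q; have [->|] := eqVneq q n; lia.
have [t0|t_gt0] := posnP t.
  have [jn'|jn'] := ltnP j n.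
    exists q0 => //; have := le_q0 j; have := v1 q0.
    have [q00|] := eqVneq q0 0%N; first by rewrite q00; lia.
    lia.
  exists 0%N; first lia.
  have := v1 0%N; have := le_q0 0%N; have := ml (_ : q0 < j)%N; lia.
have [tj|jt] := leqP t j.
  exists n; first lia.
  have := v2 n; have := le_q0 n; have := lt_n q0; have := ge_n q0; lia.
exists q0 => //; have := v2 q0; have := v1 q0.
have := lt_n q0; have := le_q0 (j + n)%N.
have [q0n|] := eqVneq q0 n; first by rewrite q0n; lia.
lia.
Qed.

(** Matched brackets are left alone by [flip]. The bracket of letter 0 is an opening one in both
    flipped words, while the closing bracket of letter [j] that it now matches is no longer
    flipped. *)
Lemma flip_raise t : (forall q, (c q <= k q)%N) -> (t < n)%N ->
  (flip n k raise t + (t == j %% n) = flip n k c t)%N.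
Proof.
move=> ck tn; have := flipE n_gt0 kn raise_periodic (raise_le^~ ck) t.
have := flipE n_gt0 kn cn ck t; rewrite !running_min_raise //; last lia.
rewrite /raise modn_small //.
have [jn'|jn'] := ltnP j n; first by rewrite modn_small //; lia.
have -> : j = n by lia.
rewrite modnn; lia.
Qed.

Hypothesis gap0 : arc_weight n <%R k c 0 = prefix_sum c j.

(** Every other arc lies inside a gap of the word before raising, and no such gap outweighs that of
    letter 0. *)
Lemma arc_weight_raise_lt t : (0 < t < n)%N ->
  (arc_weight n <=%R k raise t <= prefix_sum c j)%N.
Proof.
move=> tn; have mn := valleyDn n_gt0 kn cn 0; have mn' := valley_raiseDn 0.
rewrite !add0n in mn mn'.
have bound r : (t < r <= n)%N -> valley k raise r <= valley k raise t ->
    (arc_weight n <=%R k raise t <= prefix_sum c r - prefix_sum c t)%N.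
  move=> tr mr; have le_r : (first_after n <=%R (valley k raise) t <= r)%N.
    by apply: first_after_le => //; lia.
  rewrite /arc_weight; have := prefix_sum_mono c le_r.
  have t_lt : (t < first_after n <=%R (valley k raise) t)%N.
    by rewrite /first_after; lia.
  rewrite !prefix_sum_raise; lia.
have v't : valley k raise t = m t + 2 by rewrite valley_raise; lia.
have v'0 : valley k raise 0 = m 0 + 1 by rewrite valley_raise //; lia.
have m0t := record0_lt (proj2 (andP tn)).
have le_raise r : (t < r <= n)%N -> m r <= m t -> valley k raise r <= valley k raise t.
  move=> tr mr; have [->|rn] := eqVneq r n; first lia.
  rewrite valley_raise; lia.
have [tj|jt] := ltnP t j.
  apply: leq_trans (leq_subr (prefix_sum c t) _); apply: bound; first lia.
  by apply: le_raise; [lia|have := ml tj; lia].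
(* [t] lies in the gap of the record [r] where the valleys over [j, t] first
   reach their minimum, and that gap weighs at most as much as the gap of 0. *)
have [|r [jr w_le lt_r]] := @window_first_min (t - j).+1 m _ j; first by [].
have rt : (r <= t)%N by lia.
have rec_r : record n k c r.
  move=> l rl; have := valleyDn n_gt0 kn cn r; have [ln|nl] := ltnP l n.
    by have := record0_lt ln; have := w_le j; lia.
  have := valleyDn n_gt0 kn cn (l - n)%N; rewrite subnK //.
  have [lj|jl] := ltnP (l - n) j; first by have := ml lj; have := w_le j; lia.
  by have := lt_r (l - n)%N; lia.
have mr : m n < m r by have := record0_lt (_ : r < n)%N; lia.
have [|r' [rr' mr' mlr weightr]] := @first_drop r n _ mr; first lia.
have tr' : (t < r')%N.
  rewrite ltnNge; apply/negP => r't; have := w_le r'; lia.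
have := heavy.2 r rec_r; rewrite gap0 weightr => le_j; apply: leq_trans le_j.
apply: leq_trans (bound r' _ _) _; [lia| |].
  by apply: le_raise; [lia|have := w_le t; lia].
have := prefix_sum_mono c rt; lia.
Qed.

End Raise.

Lemma flip_raise_exists n k c : (0 < n)%N -> (forall t, k (t + n)%N = k t) ->
  (forall t, c (t + n)%N = c t) -> (forall t, (c t <= k t)%N) ->
  2 <= deficit n k c -> heaviest n k c 0 ->
  exists2 j, (j < n)%N &
    forall t, (t < n)%N -> (flip n k (raise n c) t + (t == j))%N = flip n k c t.
Proof.
move=> n_gt0 kn cn ck u_ge2 heavy.
have [j [jn mj ml _]] := first_gap n_gt0 kn cn u_ge2.
exists (j %% n)%N; first by rewrite ltn_mod.
by move=> t tn; apply: (flip_raise n_gt0 kn cn u_ge2 heavy jn mj ml ck tn).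
Qed.

(** The raised letter is thus recognizable in the raised word, which makes the upward move injective
    on orbits. *)
Lemma arc_weight_raise_unique n k c t : (0 < n)%N -> (forall t, k (t + n)%N = k t) ->
  (forall t, c (t + n)%N = c t) -> 2 <= deficit n k c -> heaviest n k c 0 ->
  (0 < t < n)%N -> (arc_weight n <=%R k (raise n c) t < arc_weight n <=%R k (raise n c) 0)%N.
Proof.
move=> n_gt0 kn cn u_ge2 heavy tn.
have [j [jn mj ml gap0]] := first_gap n_gt0 kn cn u_ge2.
rewrite (arc_weight_raise0 n_gt0 kn cn u_ge2 jn mj ml) ltnS.
exact: (arc_weight_raise_lt n_gt0 kn cn u_ge2 heavy jn mj ml gap0 tn).
Qed.

Lemma flip_ge n k c t : (0 < n)%N -> (forall t, k (t + n)%N = k t) ->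
  (forall t, c (t + n)%N = c t) -> (forall t, (c t <= k t)%N) ->
  0 <= deficit n k c -> (c t <= flip n k c t)%N.
Proof.
move=> n_gt0 kn cn ck u_ge0; have := flipE n_gt0 kn cn ck t.
have [] := running_minS_le n_gt0 kn cn t u_ge0; lia.
Qed.

Local Close Scope ring_scope.

(** * Words over a symmetric chain order *)

Section Letters.
Context {d : Order.disp_t} {P : finPOrderType d}.
Variables (rk : P -> nat) (C : {set {set P}}).
Implicit Types (p q : P) (A : {set P}).
Local Open Scope nat_scope.
Local Notation R := (poset_rank rk).

Definition cap p : nat := #|pblock C p|.-1.
(* The ends of the chain of [p], of ranks [rk p - pos p] and
   [rk p - pos p + cap p], have ranks summing to [R]. *)
Definition pos p : nat := (2 * rk p + cap p - R)./2.
Definition at_pos p j : P := odflt p [pick q in pblock C p | pos q == j].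

Hypothesis rk_covers : rank_function rk.
Hypothesis C_part : partition C [set: P].
Hypothesis C_chain : {in C, forall A, symmetric_chain rk A}.

Lemma path_rank x s i : path covers x s -> i <= size s -> rk (nth x (x :: s) i) = rk x + i.
Proof.
move=> xs; elim: i => [|i IHi] ltis; first by rewrite addn0.
by have /rk_covers-> := pathP x xs _ ltis; rewrite IHi ?addnS // ltnW.
Qed.

Lemma pblockE p q : q \in pblock C p -> pblock C q = pblock C p.
Proof.
have /and3P[_ tC _] := C_part => qp.
by rewrite (same_pblock tC qp).
Qed.

(** Ranks grow by one along the chain [x :: s], so it has no repetition, and rank-symmetry turns
    [pos] into the index in it. *)
Lemma letter_chain p : exists x s, [/\ path covers x s, size s = cap p,
  p = nth x (x :: s) (pos p),
    pos p <= cap p /\ 2 * rk p + cap p = R + 2 * pos p &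
  forall j, j <= cap p -> pos (nth x (x :: s) j) = j /\ at_pos p j = nth x (x :: s) j].
Proof.
have /and3P[/eqP cC tC _] := C_part.
have pC : p \in cover C by rewrite cC inE.
have [x [s [AE xs rkR]]] := C_chain (pblock_mem pC).
have rkE := path_rank xs.
have rk_last : rk (last x s) = rk x + size s by rewrite (last_nth x) rkE.
have uniq_s : uniq (x :: s).
  apply/(uniqP x) => i j; rewrite !inE !ltnS => is_ js E.
  by have := rkE i is_; rewrite E rkE //; lia.
have capE : size s = cap p by rewrite /cap (eq_card AE) (card_uniqP uniq_s).
have posE q i : q = nth x (x :: s) i -> i <= size s -> pos q = i.
  move=> qE is_; have qA : q \in pblock C p by rewrite AE qE mem_nth.
  have capq : cap q = cap p by rewrite /cap (pblockE qA).
  by rewrite /pos capq -capE qE rkE // -rkR rk_last; lia.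
have nthP q : q \in pblock C p -> q = nth x (x :: s) (pos q) /\ pos q <= size s.
  rewrite AE => qs; have qi := nth_index x qs; have := index_mem q (x :: s).
  rewrite qs ltnS => is_; by rewrite (posE q _ (esym qi)) ?qi.
have [pE pos_le] := nthP p ltac:(by rewrite mem_pblock).
have rkp : 2 * rk p + size s = R + 2 * pos p by rewrite [in rk p]pE rkE // -rkR; lia.
exists x, s; split; rewrite -?capE // => j js; split; first exact: posE.
rewrite /at_pos; case: pickP => [q /andP[qA /eqP <-]|/(_ (nth x (x :: s) j))].
  by case: (nthP q qA).
by rewrite AE mem_nth // (posE _ j) // eqxx.
Qed.

Lemma pos_le p : pos p <= cap p.
Proof. by have [x [s [_ _ _ []]]] := letter_chain p. Qed.

Lemma at_pos_mem p j : at_pos p j \in pblock C p.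
Proof.
have /and3P[/eqP cC _ _] := C_part.
by rewrite /at_pos; case: pickP => [q /andP[]|_] //=; rewrite mem_pblock cC inE.
Qed.

Lemma cap_at_pos p j : cap (at_pos p j) = cap p.
Proof. by rewrite /cap (pblockE (at_pos_mem p j)). Qed.

Lemma pos_at_pos p j : j <= cap p -> pos (at_pos p j) = j.
Proof. by have [x [s [_ _ _ _ H]]] := letter_chain p; case/H=> + ->. Qed.

Lemma at_posK p : at_pos p (pos p) = p.
Proof.
by have [x [s [_ _ pE [pp _] H]]] := letter_chain p; rewrite [RHS]pE; case: (H _ pp).
Qed.

Lemma at_pos_at_pos p i j : j <= cap p -> at_pos (at_pos p i) j = at_pos p j.
Proof.
move=> jp; rewrite {1 3}/at_pos (pblockE (at_pos_mem p i)).
case: pickP => // /(_ (at_pos p j)).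
by rewrite at_pos_mem pos_at_pos // eqxx.
Qed.

Lemma covers_at_pos p j : j < cap p -> covers (at_pos p j) (at_pos p j.+1).
Proof.
have [x [s [xs sE _ _ H]]] := letter_chain p => jp.
rewrite (H _ jp).2 (H _ (ltnW jp)).2; apply: (pathP x xs); by rewrite sE.
Qed.

Lemma rank_pos p : 2 * rk p + cap p = R + 2 * pos p.
Proof. by have [x [s [_ _ _ []]]] := letter_chain p. Qed.

End Letters.

(** * Periodic words, rotations and the ranked poset of necklaces *)

Section Words.
Context {d : Order.disp_t} (P : finPOrderType d) (n : nat).
Hypothesis n_gt0 : (0 < n)%N.
Implicit Types (x y : n.-tupleprod P) (a b : necklace P n).
Local Open Scope nat_scope.

Definition letter x t : P := tnth x (Ordinal (ltn_pmod t n_gt0)).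

Lemma letter_ord x (i : 'I_n) : letter x i = tnth x i.
Proof. by rewrite /letter; congr tnth; apply: val_inj; rewrite /= modn_small. Qed.

Lemma letter_mod x t : letter x (t %% n) = letter x t.
Proof. by rewrite /letter; congr tnth; apply: val_inj; rewrite /= modn_mod. Qed.

Lemma letter_periodic x t : letter x (t + n) = letter x t.
Proof. by rewrite -letter_mod modnDr letter_mod. Qed.

Lemma eq_word x y : (forall t, t < n -> letter x t = letter y t) -> x = y.
Proof. by move=> xy; apply: eq_from_tnth => i; rewrite -!letter_ord xy. Qed.

Definition rotation x y : Prop := exists e, forall t, letter x t = letter y (t + e).

Lemma letter_permute x e t :
  letter (permute_coords x (perm (@ordS_inj n) ^+ e)%g) (t + e) = letter x t.
Proof.
pose i := Ordinal (ltn_pmod t n_gt0).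
have iE : nat_of_ord ((perm (@ordS_inj n) ^+ e)%g i) = (t + e) %% n.
  elim: e => [|e IHe]; first by rewrite expg0 perm1 addn0.
  by rewrite expgSr permM permE /= IHe -addn1 modnDml addn1 addnS.
by rewrite -letter_mod -iE letter_ord tnth_permute permK -letter_ord letter_mod.
Qed.

Lemma necklace_rotation a x y : x \in val a -> y \in val a -> rotation x y.
Proof.
move=> xa; rewrite (necklaceE xa) => /orbitP[s /cycleP[e ->] <-].
by exists e => t; rewrite /= letter_permute.
Qed.

Lemma rotation_necklace a x y : x \in val a -> rotation x y -> y \in val a.
Proof.
move=> xa [e xy]; suff -> : y = permute_coords x (perm (@ordS_inj n) ^+ e)%g.
  by apply: necklaceJ => //; apply: mem_cycle.
apply: eq_word => t _.
(* Adding [e * n], a multiple of the period, keeps the subtraction of [e] from being truncated. *)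
have back w : letter w t = letter w (t + e * n - e + e).
  rewrite subnK; last by rewrite (leq_trans (leq_pmulr e n_gt0)) ?leq_addl.
  by rewrite -letter_mod -[RHS]letter_mod addnC modnMDl.
by rewrite [LHS]back [RHS]back letter_permute xy.
Qed.

Definition necklace_of x : necklace P n :=
  Necklace (imset_f (fun x => orbit (coord_action P n) (cyclic_shifts n) x) (in_setT x)).

Lemma mem_necklace_of x : x \in val (necklace_of x).
Proof. exact: orbit_refl. Qed.

Lemma necklace_of_mem a x : x \in val a -> necklace_of x = a.
Proof. by move=> xa; apply: val_inj; rewrite (necklaceE xa). Qed.

Lemma eq_necklace_of x y : rotation x y -> necklace_of x = necklace_of y.
Proof.
move=> xy; apply/esym/necklace_of_mem.
exact: rotation_necklace (mem_necklace_of x) xy.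
Qed.

Variable rk : P -> nat.
Hypothesis rk_covers : rank_function rk.

Lemma necklace_rank_of x : necklace_rank rk (necklace_of x) = power_rank rk x.
Proof. exact/necklace_rankE/mem_necklace_of. Qed.

Lemma necklace_le_of x y : (x <= y)%O -> (necklace_of x <= necklace_of y)%O.
Proof.
move=> xy; apply/(necklace_leP _ (mem_necklace_of x)).
by exists y; rewrite ?mem_necklace_of.
Qed.

Lemma power_rankE x : power_rank rk x = prefix_sum (fun t => rk (letter x t)) n.
Proof. by apply: eq_bigr => i _; rewrite letter_ord. Qed.

(** Raising one coordinate of [x] to a cover below that of [y] gives a word [z] between them of rank
    one more than [x]; its orbit differs from that of [x], hence is that of [y]. *)
Lemma necklace_rank_function : rank_function (necklace_rank (n := n) rk).
Proof.
move=> a b /andP[ab /forallP no_between].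
have [x xa] := necklace_neq0 a.
have /(necklace_leP _ xa)[y yb xy] := ltW ab.
have [i xyi] : exists i, (tnth x i < tnth y i)%O.
  have [/existsP//|] := boolP [exists i, (tnth x i < tnth y i)%O].
  rewrite negb_exists => /forallP xyn; case/eqP: (lt_eqF ab).
  rewrite -(necklace_of_mem xa) -(necklace_of_mem yb); congr necklace_of.
  apply: eq_from_tnth => i; apply/eqP; have := xyn i.
  move: xy; rewrite Order.TupleProdOrder.leEtprod => /forallP/(_ i).
  by rewrite lt_neqAle => ->; rewrite andbT negbK.
have [p xp py] := covers_between xyi.
pose z : n.-tupleprod P := [tuple if j == i then p else tnth x j | j < n].
have zE j : tnth z j = if j == i then p else tnth x j by rewrite tnth_mktuple.
have xz : (x <= z)%O.
  rewrite Order.TupleProdOrder.leEtprod; apply/forallP => j; rewrite zE.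
  by case: eqP => // ->; apply: ltW; case/andP: xp.
have zy : (z <= y)%O.
  rewrite Order.TupleProdOrder.leEtprod; apply/forallP => j; rewrite zE.
  case: eqP => [->//|_].
  by move: xy; rewrite Order.TupleProdOrder.leEtprod => /forallP/(_ j).
have rkz : power_rank rk z = (power_rank rk x).+1.
  rewrite /power_rank (bigD1 i) //= (bigD1 i (F := fun j => rk (tnth x j))) //=.
  rewrite zE eqxx (rk_covers xp) addSn; congr (_ + _).+1.
  by apply: eq_bigr => j /negPf ji; rewrite zE ji.
have := no_between (necklace_of z).
rewrite -(necklace_of_mem xa) -(necklace_of_mem yb).
rewrite !lt_neqAle !necklace_le_of // !andbT negb_and !negbK => /orP[/eqP E|/eqP<-].
  by have := congr1 (necklace_rank rk) E; rewrite !necklace_rank_of rkz; lia.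
by rewrite !necklace_rank_of.
Qed.

Lemma covers_necklace_of x y : (x <= y)%O -> power_rank rk y = (power_rank rk x).+1 ->
  covers (necklace_of x) (necklace_of y).
Proof.
move=> xy rkE; apply/andP; split.
  rewrite lt_neqAle necklace_le_of // andbT; apply/eqP => E.
  by have := congr1 (necklace_rank rk) E; rewrite !necklace_rank_of; lia.
apply/forallP => z; apply/negP => /andP[/(rank_lt necklace_rank_function) xz].
move/(rank_lt necklace_rank_function); move: xz.
rewrite !necklace_rank_of; lia.
Qed.

(** The necklace [a] witnesses that [P] is inhabited; the extreme ranks are reached at constant
    words. *)
Lemma poset_rank_necklace :
  forall a, poset_rank (necklace_rank (n := n) rk) = n * poset_rank rk.
Proof.
move=> a; have [x _] := necklace_neq0 a; pose p0 := letter x 0.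
have [q _ max_q] := @arg_maxnP _ p0 predT rk isT.
have [p _ min_p] := @arg_minnP _ p0 predT rk isT.
have constE r : necklace_rank rk (necklace_of [tuple r | i < n]) = n * rk r.
  rewrite necklace_rank_of /power_rank (eq_bigr (fun=> rk r)).
    by rewrite sum_nat_const card_ord.
  by move=> i _; rewrite tnth_mktuple.
have rank_bound b : n * rk p <= necklace_rank rk b <= n * rk q.
  have [y yb] := necklace_neq0 b; rewrite (necklace_rankE rk yb) /power_rank.
  rewrite -[n in n * _]card_ord -[n in _ <= n * _]card_ord -!sum_nat_const.
  by apply/andP; split; apply: leq_sum => i _; [apply: min_p|apply: max_q].
rewrite /poset_rank mulnDr (max_rank_eq (x := q)) ?(min_rank_eq (x := p)) => [|v|v].
- rewrite (max_rank_eq (x := necklace_of [tuple q | i < n])) => [|b].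
    rewrite (min_rank_eq (x := necklace_of [tuple p | i < n])) => [|b].
      by rewrite !constE.
    by rewrite constE; case/andP: (rank_bound b).
  by rewrite constE; case/andP: (rank_bound b).
- exact: min_p.
exact: max_q.
Qed.
End Words.

(** * Bracket operations on words and the symmetric chains of necklaces *)

Section NecklaceChains.
Context {d : Order.disp_t} (P : finPOrderType d) (n : nat) (rk : P -> nat).
Variable C : {set {set P}}.
Hypothesis n_gt0 : (0 < n)%N.
Hypothesis rk_covers : rank_function rk.
Hypothesis C_part : partition C [set: P].
Hypothesis C_chain : {in C, forall A, symmetric_chain rk A}.
Implicit Types (x y : n.-tupleprod P) (a b : necklace P n) (c : nat -> nat).
Local Open Scope nat_scope.
Local Notation R := (poset_rank rk).

Definition caps x t : nat := cap C (letter n_gt0 x t).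
Definition poss x t : nat := pos rk C (letter n_gt0 x t).
Definition set_pos x c : n.-tupleprod P :=
  [tuple at_pos rk C (tnth x i) (c i) | i < n].

Lemma caps_periodic x t : caps x (t + n) = caps x t.
Proof. by rewrite /caps letter_periodic. Qed.

Lemma poss_periodic x t : poss x (t + n) = poss x t.
Proof. by rewrite /poss letter_periodic. Qed.

Lemma poss_le x t : poss x t <= caps x t.
Proof. exact: pos_le. Qed.

Lemma letter_set_pos x c t : (forall q, c (q + n) = c q) ->
  letter n_gt0 (set_pos x c) t = at_pos rk C (letter n_gt0 x t) (c t).
Proof.
move=> cn; rewrite /letter tnth_mktuple /=; congr at_pos.
exact: periodic_mod.
Qed.

Lemma caps_set_pos x c t : (forall q, c (q + n) = c q) -> caps (set_pos x c) t = caps x t.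
Proof. by move=> cn; rewrite /caps letter_set_pos // cap_at_pos. Qed.

Lemma poss_set_pos x c t : (forall q, c (q + n) = c q) -> c t <= caps x t ->
  poss (set_pos x c) t = c t.
Proof.
move=> cn ct; rewrite /poss letter_set_pos //.
exact: (pos_at_pos rk_covers C_part C_chain).
Qed.

Lemma set_pos_poss x c : (forall t, t < n -> c t = poss x t) -> set_pos x c = x.
Proof.
move=> cE; apply: eq_from_tnth => i; rewrite tnth_mktuple cE // /poss letter_ord.
exact: (at_posK rk_covers C_part C_chain).
Qed.

Lemma power_rank_poss x :
  2 * power_rank rk x + prefix_sum (caps x) n = n * R + 2 * prefix_sum (poss x) n.
Proof.
rewrite (power_rankE n_gt0) /prefix_sum -[n in n * R]card_ord -sum_nat_const.
rewrite !big_distrr -!big_split; apply: eq_bigr => t _ /=.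
exact: (rank_pos rk_covers C_part C_chain).
Qed.

(** The sign of the deficit locates a word relative to the middle rank; a deficit of at least 2
    leaves room for an upward step. *)
Lemma deficit_rank x :
  (deficit n (caps x) (poss x) = (n * R)%:Z - (2 * power_rank rk x)%:Z)%R.
Proof. have := power_rank_poss x; rewrite /deficit; lia. Qed.

Lemma covers_set_pos x c c' i : i < n ->
  (forall t, t < n -> c' t = c t + (t == i)) -> (forall t, t < n -> c' t <= caps x t) ->
  covers (necklace_of (set_pos x c)) (necklace_of (set_pos x c')).
Proof.
move=> i_lt c'E c'_le; pose i' := Ordinal i_lt.
have cov : covers (tnth (set_pos x c) i') (tnth (set_pos x c') i').
  rewrite !tnth_mktuple /= c'E // eqxx addn1.
  apply: (covers_at_pos rk_covers C_part C_chain).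
  by have := c'_le i i_lt; rewrite c'E // eqxx addn1 -(letter_ord n_gt0).
have eq_other (j : 'I_n) : j != i' -> tnth (set_pos x c') j = tnth (set_pos x c) j.
  by rewrite -val_eqE !tnth_mktuple c'E // => /negPf->; rewrite addn0.
apply: (covers_necklace_of n_gt0 rk_covers).
  rewrite Order.TupleProdOrder.leEtprod; apply/forallP => j.
  by have [->|/eq_other->//] := eqVneq j i'; apply: ltW; case/andP: cov.
rewrite /power_rank (bigD1 i') //= [in RHS](bigD1 i') //= (rk_covers cov) addSn.
by congr (_ + _).+1; apply: eq_bigr => j /eq_other->.
Qed.

Definition dual_word x : n.-tupleprod P := set_pos x (flip n (caps x) (poss x)).

Let flip_per x t : flip n (caps x) (poss x) (t + n) = flip n (caps x) (poss x) t.
Proof. exact: (flip_periodic n_gt0 (caps_periodic x) (poss_periodic x) (poss_le x)). Qed.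

Let flip_cap x t : flip n (caps x) (poss x) t <= caps x t.
Proof. exact: (flip_le n_gt0 (caps_periodic x) (poss_periodic x) (poss_le x)). Qed.

Lemma caps_dual x t : caps (dual_word x) t = caps x t.
Proof. exact: caps_set_pos. Qed.

Lemma poss_dual x t : poss (dual_word x) t = flip n (caps x) (poss x) t.
Proof. exact: poss_set_pos. Qed.

Lemma set_pos_set_pos x c c' : (forall t, t < n -> c' t <= caps x t) ->
  set_pos (set_pos x c) c' = set_pos x c'.
Proof.
move=> c'_le; apply: eq_from_tnth => i; rewrite !tnth_mktuple.
apply: (at_pos_at_pos rk_covers C_part C_chain).
by have := c'_le i (ltn_ord i); rewrite /caps letter_ord.
Qed.

Lemma dual_wordK x : dual_word (dual_word x) = x.
Proof.
have E t : flip n (caps (dual_word x)) (poss (dual_word x)) t = poss x t.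
  (* A shift by 0 turns pointwise equalities into an equality of flips. *)
  have cE s : caps (dual_word x) s = caps x (s + 0) by rewrite addn0 caps_dual.
  have pE s : poss (dual_word x) s = flip n (caps x) (poss x) (s + 0).
    by rewrite addn0 poss_dual.
  rewrite (flip_shift n_gt0 cE pE) addn0.
  exact: (flipK n_gt0 (caps_periodic x) (poss_periodic x) (poss_le x)).
rewrite {1}/dual_word set_pos_set_pos => [|t _]; last by rewrite E poss_le.
exact: set_pos_poss.
Qed.

Lemma rank_dual_word x : power_rank rk x + power_rank rk (dual_word x) = n * R.
Proof.
have := sum_flip n_gt0 (caps_periodic x) (poss_periodic x) (poss_le x).
have := power_rank_poss x; have := power_rank_poss (dual_word x).
rewrite (eq_prefix_sum n (caps_dual x)) (eq_prefix_sum n (poss_dual x)).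
lia.
Qed.

Lemma rotation_dual x y : rotation n_gt0 x y -> rotation n_gt0 (dual_word x) (dual_word y).
Proof.
move=> [e xy]; exists e => t; rewrite !letter_set_pos // xy; congr at_pos.
by apply: flip_shift => // s; rewrite /caps /poss xy.
Qed.

(** A nonnegative deficit means that [flip] lowers no position; in the middle rank it preserves
    their sum, so it changes none. *)
Lemma dual_word_mid x : 2 * power_rank rk x = n * R -> dual_word x = x.
Proof.
move=> mid; apply: set_pos_poss => t tn.
have u0 : (0 <= deficit n (caps x) (poss x))%R by rewrite deficit_rank; lia.
have le s : poss x s <= flip n (caps x) (poss x) s.
  exact: (flip_ge s n_gt0 (caps_periodic x) (poss_periodic x) (poss_le x) u0).
have := rank_dual_word x; have := power_rank_poss x; have := power_rank_poss (dual_word x).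
rewrite (eq_prefix_sum n (caps_dual x)) (eq_prefix_sum n (poss_dual x)) => E1 E2 E3.
have sumE : prefix_sum (flip n (caps x) (poss x)) n = prefix_sum (poss x) n by lia.
move: sumE; rewrite /prefix_sum (bigD1 (Ordinal tn)) //= [in RHS](bigD1 (Ordinal tn)) //=.
have := le t; have : \sum_(i < n | i != Ordinal tn) poss x i
  <= \sum_(i < n | i != Ordinal tn) flip n (caps x) (poss x) i by exact: leq_sum.
move: (\sum_(i < n | _) _) (\sum_(i < n | _) _) => S' S; lia.
Qed.

(** Here [flip] lowers no position and increases their sum by 1, so a single letter moves up, by one
    step. *)
Lemma covers_dual_word x : 2 * power_rank rk x + 1 = n * R ->
  covers (necklace_of x) (necklace_of (dual_word x)).
Proof.
move=> mid; pose f := flip n (caps x) (poss x).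
have u0 : (0 <= deficit n (caps x) (poss x))%R by rewrite deficit_rank; lia.
have le s : poss x s <= f s.
  exact: (flip_ge s n_gt0 (caps_periodic x) (poss_periodic x) (poss_le x) u0).
have := rank_dual_word x; have := power_rank_poss x; have := power_rank_poss (dual_word x).
rewrite (eq_prefix_sum n (caps_dual x)) (eq_prefix_sum n (poss_dual x)) => E1 E2 E3.
have /eqP : \sum_(i < n) (f i - poss x i) = 1.
  suff : \sum_(i < n) (f i - poss x i) + prefix_sum (poss x) n = prefix_sum f n.
    by rewrite /f; lia.
  by rewrite -big_split; apply: eq_bigr => i _; rewrite /= subnK.
move=> /sum_nat_eq1[i [_ fi f0]].
rewrite -{1}(@set_pos_poss x (poss x)) //; apply: (covers_set_pos (ltn_ord i)) => // t tn.
have := le t; have [->|ti] := eqVneq t i; first by rewrite -/f; lia.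
by have := f0 (Ordinal tn) ti isT; rewrite -/f /=; lia.
Qed.

Definition raise_word x : n.-tupleprod P := set_pos x (raise n (poss x)).

(** A relation, because several blocks may be heaviest; the representative [x] is rotated to put one
    of them after letter 0. *)
Definition up_rel a b : Prop :=
  exists x, [/\ x \in val a, heaviest n (caps x) (poss x) 0 & b = necklace_of (raise_word x)].

Section RaiseWord.
Variable x : n.-tupleprod P.
Hypothesis x_low : 2 * power_rank rk x + 2 <= n * R.
Hypothesis x_heavy : heaviest n (caps x) (poss x) 0.

Let u_ge2 : (2 <= deficit n (caps x) (poss x))%R.
Proof. by rewrite deficit_rank; lia. Qed.

Let raise_per t : raise n (poss x) (t + n) = raise n (poss x) t.
Proof. exact: (raise_periodic (poss_periodic x)). Qed.

Let raise_cap t : raise n (poss x) t <= caps x t.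
Proof.
exact: (raise_le n_gt0 (caps_periodic x) (poss_periodic x) u_ge2 x_heavy _ (poss_le x)).
Qed.

Lemma caps_raise t : caps (raise_word x) t = caps x t.
Proof. exact: caps_set_pos. Qed.

Lemma poss_raise t : poss (raise_word x) t = raise n (poss x) t.
Proof. exact: poss_set_pos. Qed.

Lemma covers_raise : covers (necklace_of x) (necklace_of (raise_word x)).
Proof.
rewrite -{1}(@set_pos_poss x (poss x)) //; apply: (covers_set_pos n_gt0) => // t tn.
by rewrite /raise modn_small.
Qed.

Lemma covers_dual_raise :
  covers (necklace_of (dual_word (raise_word x))) (necklace_of (dual_word x)).
Proof.
have [j jn flipE] := flip_raise_exists n_gt0 (caps_periodic x) (poss_periodic x)
  (poss_le x) u_ge2 x_heavy.
have E t : flip n (caps (raise_word x)) (poss (raise_word x)) t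
         = flip n (caps x) (raise n (poss x)) t.
  rewrite -[t in RHS]addn0; apply: flip_shift => // s; rewrite addn0.
    exact: caps_raise.
  exact: poss_raise.
rewrite {1}/dual_word set_pos_set_pos => [|t tn]; last by rewrite -caps_raise.
by apply: (covers_set_pos jn) => // t tn; rewrite E flipE.
Qed.

Lemma arc_weight_raise_word t : 0 < t < n ->
  arc_weight n <=%R (caps (raise_word x)) (poss (raise_word x)) t
    < arc_weight n <=%R (caps (raise_word x)) (poss (raise_word x)) 0.
Proof.
move=> t_n.
have E s : arc_weight n <=%R (caps (raise_word x)) (poss (raise_word x)) s
         = arc_weight n <=%R (caps x) (raise n (poss x)) s.
  rewrite -[s in RHS]addn0; apply: (arc_weight_shift n_gt0) => [u|u|u v w]; rewrite ?addn0.
  - exact: caps_raise.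
  - exact: poss_raise.
  exact: lerD2r.
rewrite !E.
exact: (arc_weight_raise_unique n_gt0 (caps_periodic x) (poss_periodic x) u_ge2 x_heavy t_n).
Qed.

Lemma set_pos_raise :
  set_pos (raise_word x) (fun t => poss (raise_word x) t - (t %% n == 0)) = x.
Proof.
rewrite set_pos_set_pos => [|t tn].
  by apply: set_pos_poss => t tn; rewrite poss_raise /raise addnK.
by rewrite poss_raise /raise addnK poss_le.
Qed.
End RaiseWord.

(** Were [e] not a multiple of [n], the arcs at letter 0 of the two raised words would each be
    strictly heavier than the other. Hence the raised words coincide, and lowering letter 0 recovers
    [x] and [y]. *)
Lemma raise_rotation x y :
  2 * power_rank rk x + 2 <= n * R -> heaviest n (caps x) (poss x) 0 ->
  2 * power_rank rk y + 2 <= n * R -> heaviest n (caps y) (poss y) 0 ->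
  rotation n_gt0 (raise_word x) (raise_word y) -> x = y.
Proof.
move=> xR xh yR yh [e xy].
have xy_mod t : letter n_gt0 (raise_word x) t = letter n_gt0 (raise_word y) (t + e %% n).
  by rewrite xy -letter_mod -modnDmr letter_mod.
have span_le z w k : (forall t, letter n_gt0 z t = letter n_gt0 w (t + k)) ->
    arc_weight n <=%R (caps z) (poss z) 0 = arc_weight n <=%R (caps w) (poss w) k.
  move=> zw; rewrite -[k in RHS]add0n; apply: (arc_weight_shift n_gt0) => [t|t|u v s].
  - by rewrite /caps zw.
  - by rewrite /poss zw.
  exact: lerD2r.
have [e0|e_gt0] := posnP (e %% n).
  rewrite -(set_pos_raise xR xh) -(set_pos_raise yR yh).
  suff -> : raise_word x = raise_word y by [].
  by apply: (@eq_word _ _ _ n_gt0) => t _; rewrite xy_mod e0 addn0.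
have en : e %% n < n by rewrite ltn_mod.
have yx t : letter n_gt0 (raise_word y) t = letter n_gt0 (raise_word x) (t + (n - e %% n)).
  by rewrite xy_mod -addnA subnK ?letter_periodic // ltnW.
have := arc_weight_raise_word xR xh (t := n - e %% n); rewrite -(span_le _ _ _ yx).
have := arc_weight_raise_word yR yh (t := e %% n); rewrite -(span_le _ _ _ xy_mod).
lia.
Qed.

Lemma up_rel_exists a : (2 * necklace_rank rk a + 2 <= n * R) -> exists b, up_rel a b.
Proof.
have [x xa] := necklace_neq0 a; rewrite (necklace_rankE rk xa) => xR.
have [|e xe] := heaviest_exists n_gt0 (caps_periodic x) (poss_periodic x).
  by rewrite deficit_rank; lia.
pose y : n.-tupleprod P := [tuple letter n_gt0 x (i + e) | i < n].
have yx t : letter n_gt0 y t = letter n_gt0 x (t + e).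
  by rewrite /letter tnth_mktuple /= -letter_mod modnDml letter_mod.
have ya : y \in val a.
  rewrite -(necklace_of_mem xa) -(@eq_necklace_of _ _ _ n_gt0 y x) ?mem_necklace_of //.
  by exists e.
exists (necklace_of (raise_word y)), y; split=> //.
have capE t : caps y t = caps x (t + e) by rewrite /caps yx.
have posE t : poss y t = poss x (t + e) by rewrite /poss yx.
case: xe => rec_e max_e; split; first by apply/(record_shift n_gt0 capE posE).
move=> r /(record_shift n_gt0 capE posE) /max_e.
by rewrite !(arc_weight_shift n_gt0 capE posE) // => u v w; apply: ltrD2r.
Qed.

Lemma necklace_chains : symmetric_chain_order (T := necklace P n) (necklace_rank rk).
Proof.
have rank_fun := necklace_rank_function n_gt0 rk_covers.
(* One of the possible upward moves is fixed for each necklace; where no move is required, any value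
   would do, and [a] itself is supplied. *)
have /fin_all_exists[up upP] (a : necklace P n) : exists b,
    2 * necklace_rank rk a + 2 <= n * R -> up_rel a b.
  by have [/up_rel_exists[b]|_] := boolP (2 * necklace_rank rk a + 2 <= n * R);
    [exists b|exists a].
pose word a := xchoose (necklace_neq0 a).
have wordP a : word a \in val a := xchooseP (necklace_neq0 a).
pose dual a := necklace_of (dual_word (word a)).
have dualE a x : x \in val a -> dual a = necklace_of (dual_word x).
  move=> xa; apply: (eq_necklace_of (n_gt0 := n_gt0)); apply: rotation_dual.
  exact: necklace_rotation (wordP a) xa.
have rankR a := poset_rank_necklace n_gt0 rk a.
apply: (@symmetric_chain_order_up _ _ _ dual up) => //.
- move=> a; rewrite (rankR a) (necklace_rankE rk (wordP a)) necklace_rank_of.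
  exact: rank_dual_word.
- move=> a; rewrite (dualE _ _ (mem_necklace_of (dual_word (word a)))) dual_wordK.
  exact: necklace_of_mem (wordP a).
- move=> a; rewrite (rankR a) => aR; have [x [xa xh ->]] := upP a aR.
  rewrite -{1}(necklace_of_mem xa).
  by apply: covers_raise => //; rewrite -(necklace_rankE rk xa).
- move=> a; rewrite (rankR a) => aR; have [x [xa xh ->]] := upP a aR.
  rewrite (dualE _ _ xa) (dualE _ _ (mem_necklace_of (raise_word x))).
  by apply: covers_dual_raise => //; rewrite -(necklace_rankE rk xa).
- move=> a b; rewrite (rankR a) => aR bR E.
  have [x [xa xh xE]] := upP a aR; have [y [yb yh yE]] := upP b bR.
  rewrite -(necklace_of_mem xa) -(necklace_of_mem yb); congr necklace_of.
  rewrite (necklace_rankE rk xa) in aR; rewrite (necklace_rankE rk yb) in bR.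
  apply: (raise_rotation aR xh bR yh).
  apply: (necklace_rotation n_gt0 (mem_necklace_of (raise_word x))).
  by rewrite -xE E yE mem_necklace_of.
- move=> a; rewrite (rankR a) => aR.
  rewrite -[in X in covers X _](necklace_of_mem (wordP a)).
  by apply: covers_dual_word; rewrite -(necklace_rankE rk (wordP a)).
move=> a; rewrite (rankR a) => aR; rewrite /dual dual_word_mid.
  exact: necklace_of_mem.
by rewrite -(necklace_rankE rk (wordP a)).
Qed.
End NecklaceChains.

Theorem theorem4p1 (d : Order.disp_t) (P : finPOrderType d) (rk : P -> nat)
    (n : nat) (n_ge1 : (1 <= n)%N) (P_sco : symmetric_chain_order rk) :
  symmetric_chain_order (T := necklace P n) (necklace_rank rk).
Proof.
case: P_sco => rk_covers [C [C_part C_chain]].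
exact: (necklace_chains n_ge1 rk_covers C_part C_chain).
Qed.
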